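(* Suppose that $X$ and $X^*$ are uniformly convex (real) Banach spaces. Let $A:X\rightrightarrows X^*$ be a maximal monotone operator with minimal-norm selection $A^\circ$. Then for every $x\in D(A)$ and $v\in X\setminus\{0\}$, $$\sigma_{Ax}(v)=\begin{cases}\displaystyle\liminf_{\substack{w\to v,\ t\downarrow0\\ x+tw\in D(A)}}\langle A^\circ(x+tw),w\rangle & \text{if } v\in T(x;\overline{D(A)}),\\[2mm] +\infty&\text{otherwise.}\end{cases}$$
   Context: $X^*$ is the continuous dual of the real Banach space $X$, $\langle\cdot,\cdot\rangle$ the duality pairing. For a set-valued operator $A:X\rightrightarrows X^*$, $D(A)=\{x\in X: Ax\neq\emptyset\}$. $A$ is monotone if $\langle x^*-y^*,x-y\rangle\ge 0$ whenever $x^*\in Ax$, $y^*\in Ay$, and maximal monotone if in addition its graph is not properly contained in the graph of another monotone operator. In this setting, for $x\in D(A)$ the set $Ax$ is nonempty, closed and convex, so it has a unique element of minimal norm, denoted $A^\circ x$; the map $A^\circ:D(A)\to X^*$ is the minimal-norm selection of $A$. The closure $\overline{D(A)}$ (norm topology) is convex. Support function: $\sigma_{Ax}(v)=\sup\{\langle x^*,v\rangle:x^*\in Ax\}\in\mathbb{R}\cup\{+\infty\}$. Tangent cone: for a nonempty closed convex $S\subset X$ and $x\in S$, $T(x;S)=\overline{\bigcup_{t>0}t^{-1}(S-x)}$. The $\liminf$ is taken over pairs $(w,t)\in X\times(0,\infty)$ with $w\to v$ in norm, $t\to0$, and $x+tw\in D(A)$; i.e. it is $\sup_{\varepsilon>0}\inf\{\langle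 A^\circ(x+tw),w\rangle:\|w-v\|<\varepsilon,\ 0<t<\varepsilon,\ x+tw\in D(A)\}$, with values in $\mathbb{R}\cup\{+\infty\}$. *)

(* Defs.v *)
From HB Require Import structures.
From mathcomp Require Import all_boot all_order all_algebra.
From mathcomp Require Import all_classical all_reals all_analysis.

Set Implicit Arguments.
Unset Strict Implicit.
Unset Printing Implicit Defensive.

Import Order.TTheory GRing.Theory Num.Theory.
Import numFieldNormedType.Exports.

Local Open Scope classical_set_scope.
Local Open Scope ring_scope.

Section dual.
Context {R : realType} (X : normedModType R).

Definition dual_pred : {pred X -> R} :=
  fun f => `[< linear f /\ continuous f >].

(* The topological dual of X, normed by the operator norm [dual_norm]. *)
Record dual := Dual { dual_fun :> X -> R ; dual_funP : dual_fun \in dual_pred }.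

HB.instance Definition _ := [isSub for dual_fun].
HB.instance Definition _ := [Choice of dual by <:].

Lemma dual_pred_submod : submod_closed dual_pred.
Proof.
split=> [|a f g /asboolP[lf cf] /asboolP[lg cg]]; apply/asboolP; split.
- by move=> b x y /=; rewrite scaler0 addr0.
- by move=> x; exact: cvg_cst.
- by move=> b x y; rewrite !fctE lf lg !scalerDr !scalerA mulrC addrACA.
- move=> x; apply: (@continuousD _ _ _ (a *: f) g); last exact: cg.
  by apply: continuousZl_tmp; exact: cf.
Qed.

HB.instance Definition _ := GRing.isSubmodClosed.Build R (X -> R) dual_pred
  dual_pred_submod.
HB.instance Definition _ := [SubChoice_isSubLmodule of dual by <:].

Definition dual_norm (f : dual) : R := sup [set `|f x| | x in [set x | `|x| <= 1]].

Lemma dual_linear (f : dual) : linear f.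
Proof. by have /asboolP[] := dual_funP f. Qed.

Lemma dual_continuous (f : dual) : continuous f.
Proof. by have /asboolP[] := dual_funP f. Qed.

HB.instance Definition _ (f : dual) :=
  GRing.isLinear.Build R X R _ (dual_fun f) (dual_linear f).

Lemma dual_has_sup (f : dual) :
  has_sup [set `|f x| | x in [set x | `|x| <= 1]].
Proof.
split; first by exists `|f 0|, 0 => //=; rewrite normr0.
have /bounded_funP/(_ 1)[M fM] : bounded_near f (nbhs (0 : X)).
  by apply/linear_bounded_continuous; exact: dual_continuous.
by exists M => _ [x x1 <-]; exact: fM.
Qed.

Lemma dual_norm_ub (f : dual) (x : X) : `|x| <= 1 -> `|f x| <= dual_norm f.
Proof. by move=> x1; apply: ub_le_sup; [case: (dual_has_sup f)|exists x]. Qed.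

Lemma dual_norm_le (f : dual) (M : R) :
  (forall x : X, `|x| <= 1 -> `|f x| <= M) -> dual_norm f <= M.
Proof.
move=> fM; apply: ge_sup; first by case: (dual_has_sup f).
by move=> _ [x x1 <-]; exact: fM.
Qed.

Lemma dual_normD (f g : dual) : dual_norm (f + g) <= dual_norm f + dual_norm g.
Proof.
apply: dual_norm_le => x x1.
by rewrite (le_trans (ler_normD _ _))// lerD// dual_norm_ub.
Qed.

Let dual_normZ_le (a : R) (f : dual) : dual_norm (a *: f) <= `|a| * dual_norm f.
Proof.
by apply: dual_norm_le => x x1; rewrite normrM ler_wpM2l// dual_norm_ub.
Qed.

Lemma dual_normZ (a : R) (f : dual) : dual_norm (a *: f) = `|a| * dual_norm f.
Proof.
apply/eqP; rewrite eq_le dual_normZ_le/=.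
have [->|a0] := eqVneq a 0.
  rewrite normr0 mul0r scale0r; apply: le_trans (dual_norm_ub _ (x := 0) _) => //.
  by rewrite normr0.
rewrite -{1}(scalerK a0 f).
rewrite -[leRHS]mul1r -(mulfV (x := `|a|)) ?normr_eq0// -mulrA ler_wpM2l//.
by rewrite -normfV dual_normZ_le.
Qed.

Lemma dual_norm0_eq0 (f : dual) : dual_norm f = 0 -> f = 0.
Proof.
move=> f0; apply/val_inj/funext => x /=.
have [->|x0] := eqVneq x 0; first by rewrite linear0.
have nx0 : `|x| != 0 by rewrite normr_eq0.
have : `|f (`|x|^-1 *: x)| <= 0.
  rewrite -f0 dual_norm_ub// normrZ normfV normr_id mulVf//.
rewrite normr_le0 linearZ/= scaler_eq0 invr_eq0 (negPf nx0)/=.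
by move=> /eqP.
Qed.

HB.instance Definition _ :=
  Lmodule_isNormed.Build R dual dual_normD dual_normZ dual_norm0_eq0.

End dual.

Section definitions.
Context {R : realType}.

Definition uniformly_convex (V : normedModType R) : Prop :=
  forall eps : R, 0 < eps -> exists2 delta : R, 0 < delta &
    forall x y : V, `|x| <= 1 -> `|y| <= 1 -> eps <= `|x - y| ->
      `|2^-1 *: (x + y)| <= 1 - delta.

Context {X : normedModType R}.
Implicit Types (A B : X -> set (dual X)) (x v : X).

Definition dom A : set X := [set x | A x !=set0].

Definition graph A : set (X * dual X) := [set p | A p.1 p.2].

Definition monotone A : Prop :=
  forall x y (x' y' : dual X), A x x' -> A y y' -> 0 <= (x' - y') (x - y).

Definition maximal_monotone A : Prop :=
  monotone A /\ forall B, monotone B -> ~ (graph A `<` graph B).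

(* Junk value [point] when [A x] has no element of minimal norm. *)
Definition min_norm_sel A x : dual X :=
  get [set x' | A x x' /\ forall y', A x y' -> `|x'| <= `|y'|].

Definition support_fun (C : set (dual X)) v : \bar R :=
  ereal_sup [set (x' v)%:E | x' in C].

Definition tangent_cone x (S : set X) : set X :=
  closure (\bigcup_(t in [set t : R | 0 < t]) [set t^-1 *: (s - x) | s in S]).

(* The infimum over an empty set of pairs is +oo. *)
Definition liminf_min_norm_sel A x v : \bar R :=
  ereal_sup [set ereal_inf
    [set (min_norm_sel A (x + p.2 *: p.1) p.1)%:E | p in
      [set p : X * R | [/\ `|p.1 - v| < eps, 0 < p.2 < eps
                         & dom A (x + p.2 *: p.1)]]]
  | eps in [set eps : R | 0 < eps]].

End definitions.

(* Main.v *)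
From HB Require Import structures.
Require Import Defs.
From mathcomp Require Import all_boot all_order all_algebra.
From mathcomp Require Import all_classical all_reals all_analysis.
From mathcomp Require Import ring lra.
Import Order.TTheory GRing.Theory Num.Theory.
Import numFieldNormedType.Exports.
Local Open Scope classical_set_scope.
Local Open Scope ring_scope.

(* Monotonicity gives sigma_{Ax}(v) <= liminf. Conversely let
   s = sigma_{Ax}(v) be finite. For t, mu > 0 the resolvent of A at x + t v with
   parameter t mu is x + t w with a in A(x + t w), a = - J(w - v) / mu. Testing
   monotonicity against x* in Ax with <x*, v> close to s yields
   |w - v|^2 / mu <= <a, v> - <x*, v> + |x*| |w - v|. As t -> 0 with mu fixed,
   weak limits of bounded elements of A(x + t w) lie in Ax, so <a, v> and
   <A°(x + t w), v> exceed s by arbitrarily little; hence w is close to v for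
   small mu, and <A°(x + t w), w - v> <= |a| |w - v| = |w - v|^2 / mu is small.
   Thus the liminf is at most s, and v is a limit of directions w with
   x + t w in D(A), that is, v is tangent: outside the tangent cone
   sigma_{Ax}(v) = +oo. Resolvents exist by minimizing the Fitzpatrick function
   plus a quadratic term on X x X*; weak compactness arguments are replaced by
   the Cauchy property of almost norm-minimal sequences in uniformly convex
   spaces. *)

Set Implicit Arguments.
Unset Strict Implicit.

(** * Evaluation and norm estimates in the dual *)

Lemma lipschitz_fun_continuous {R : realType} (V : normedModType R)
    (h : V -> R) (K : R) :
  (forall x y, `|h x - h y| <= K * `|x - y|) -> continuous h.
Proof.
move=> hK x; apply/cvgrPdist_lt => e e0.
have K0 : 0 < `|K| + 1 by rewrite ltr_wpDl.
apply/nbhs_normP; exists (e / (`|K| + 1)); first by rewrite /= divr_gt0.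
move=> y /=; rewrite ltr_pdivlMr// => xy.
apply: (le_lt_trans (hK _ _)); apply: le_lt_trans xy.
by rewrite mulrC ler_wpM2l// (le_trans (ler_norm K))// lerDl.
Qed.

Section dual_facts.
Context {R : realType} (X : normedModType R).
Implicit Types (f g : dual X) (x y : X) (a : R).

Lemma dual_addE f g x : (f + g) x = f x + g x. Proof. by []. Qed.
Lemma dual_oppE f x : (- f) x = - f x. Proof. by []. Qed.
Lemma dual_subE f g x : (f - g) x = f x - g x. Proof. by []. Qed.
Lemma dual_scaleE a f x : (a *: f) x = a * f x. Proof. by []. Qed.
Lemma dual_appD f x y : f (x + y) = f x + f y. Proof. exact: linearD. Qed.
Lemma dual_appN f x : f (- x) = - f x. Proof. exact: linearN. Qed.
Lemma dual_appB f x y : f (x - y) = f x - f y. Proof. exact: linearB. Qed.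
Lemma dual_appZ f a x : f (a *: x) = a * f x. Proof. exact: linearZ. Qed.
Lemma dual_app0 f : f 0 = 0. Proof. exact: linear0. Qed.

Definition dualE := (dual_addE, dual_subE, dual_oppE, dual_scaleE,
  dual_appD, dual_appB, dual_appN, dual_appZ).

Lemma dual_le f x : `|f x| <= `|f| * `|x|.
Proof.
have [->|x0] := eqVneq x 0; first by rewrite dual_app0 !normr0 mulr0.
have nx0 : 0 < `|x| by rewrite normr_gt0.
have -> : f x = `|x| * f (`|x|^-1 *: x).
  by rewrite dual_appZ mulrA mulfV ?mul1r// gt_eqF.
rewrite normrM normr_id mulrC ler_wpM2r//.
by apply: dual_norm_ub; rewrite normrZ normfV normr_id mulVf// gt_eqF.
Qed.

Lemma dual_app_le f x : f x <= `|f| * `|x|.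
Proof. exact: le_trans (ler_norm _) (dual_le f x). Qed.

Lemma dual_app_ge f x : - (`|f| * `|x|) <= f x.
Proof. by have := dual_le f x; rewrite ler_norml => /andP[]. Qed.

Lemma dual_eval_continuous x : continuous (fun f : dual X => f x).
Proof.
apply: (@lipschitz_fun_continuous _ _ _ `|x|) => f g.
by rewrite -dual_subE mulrC dual_le.
Qed.

Lemma linear_bounded_dual (h : X -> R) (M : R) : 0 <= M ->
  linear h -> (forall x, `|h x| <= M * `|x|) ->
  exists2 f : dual X, f = h :> (X -> R) & `|f| <= M.
Proof.
move=> M0 lh hM.
have ch : continuous h.
  pose hl := GRing.isLinear.Build R X R _ h lh.
  pose h' : {linear X -> R} := HB.pack h hl.
  apply: (@bounded_linear_continuous _ _ _ h'); apply/bounded_funP => r.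
  by exists (M * r) => x xr; apply: (le_trans (hM x)); rewrite ler_wpM2l.
have hP : h \in @dual_pred R X by apply/asboolP.
exists (Dual hP) => //.
apply: dual_norm_le => x x1; apply: (le_trans (hM x)) => /=.
by rewrite ler_piMr.
Qed.

End dual_facts.

(** * Completeness of the dual *)

Section dual_complete.
Context {R : realType} (X : normedModType R).

(** The pointwise limit [h] is linear. Fixing f and letting g run through the filter in |f x - g x|
    <= e |x| makes the convergence uniform on the unit ball; one f close to [h] shows that [h] is
    bounded. *)
Lemma dual_cauchy_cvg (F : set_system (dual X)) :
  ProperFilter F -> cauchy F -> cvg F.
Proof.
move=> FF /cauchy_ballP Fc.
have cvF x : cvg ((fun f : dual X => f x) @ F).
  apply/cauchy_cvgP/cauchy_ballP => e e0.
  have K0 : 0 < `|x| + 1 by rewrite ltr_wpDl.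
  have := Fc _ (divr_gt0 e0 K0) => -[[P Q] /= [FP FQ] PQ].
  exists ([set f x | f in P], [set f x | f in Q]) => /=.
    by split; [apply: filterS FP|apply: filterS FQ] => f ? /=; exists f.
  move=> [_ _] /= [[f Pf <-] [g Qg <-]].
  have := PQ (f, g) (conj Pf Qg); rewrite /= -!ball_normE/= ltr_pdivlMr// => fg.
  rewrite -dual_subE (le_lt_trans (dual_le _ _))//.
  by apply: le_lt_trans fg; rewrite ler_wpM2l// lerDl.
pose h x := lim ((fun f : dual X => f x) @ F).
have hP x : (fun f : dual X => f x) @ F --> h x by exact: cvF.
have lh : linear h.
  move=> a x y; apply: cvg_lim => //.
  have -> : (fun f : dual X => f (a *: x + y)) = (fun f => a * f x + f y).
    by apply/funext => f; rewrite !dualE.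
  by apply: cvgD => //; apply: cvgM => //; exact: cvg_cst.
have Fh e : 0 < e -> F [set f : dual X | forall x, `|f x - h x| <= e * `|x|].
  move=> e0; have := Fc _ e0 => -[[P Q] /= [FP FQ] PQ].
  apply: filterS FP => f Pf x.
  have fgh : (fun g : dual X => `|f x - g x|) @ F --> `|f x - h x|.
    by apply: cvg_norm; apply: cvgB => //; exact: cvg_cst.
  apply: (cvgr_to_le fgh).
  apply: filterS FQ => g Qg; rewrite -dual_subE (le_trans (dual_le _ _))//.
  have := PQ (f, g) (conj Pf Qg); rewrite /= -ball_normE/= => /ltW fg.
  by rewrite ler_wpM2r.
have [f0 f0h] := filter_ex (Fh _ ltr01).
have [|h' h'h _] := linear_bounded_dual (M := `|f0| + 1)
    (addr_ge0 (normr_ge0 _) ler01) lh.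
  move=> x; rewrite -(subrK (f0 x) (h x)) (le_trans (ler_normD _ _))//.
  by rewrite addrC mulrDl lerD ?dual_le// distrC.
apply/cvg_ex; exists h' => A /nbhs_normP[e /= e0 eA].
have e20 : 0 < e / 2 by rewrite divr_gt0.
apply: filterS (Fh _ e20) => f fh; apply: eA => /=.
apply: (@le_lt_trans _ _ (e / 2)); last by rewrite ltr_pdivrMr// ltr_pMr// ltr1n.
apply: dual_norm_le => x x1; rewrite dual_subE h'h distrC (le_trans (fh x))//.
by rewrite ler_piMr// ltW.
Qed.

HB.instance Definition _ := Uniform_isComplete.Build (dual X) dual_cauchy_cvg.

End dual_complete.

(** * Norming functionals by the Hahn-Banach argument *)

Section hahn_banach.
Context {R : realType} (X : normedModType R).

(* Graphs of partial functionals dominated by the norm; single-valuedness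
   follows from the domination. *)
Definition dominated_graph (G : set (X * R)) : Prop :=
  (forall a p q, G p -> G q -> G (a *: p.1 + q.1, a * p.2 + q.2)) /\
  (forall p, G p -> p.2 <= `|p.1|).

Lemma dominated_graph_val (G : set (X * R)) (x : X) (r s : R) :
  dominated_graph G -> G (x, r) -> G (x, s) -> r = s.
Proof.
move=> [Glin Gle].
suff H r' s' : G (x, r') -> G (x, s') -> r' <= s'.
  by move=> Gr Gs; apply/eqP; rewrite eq_le !H.
move=> Gr Gs; have := Gle _ (Glin (-1) _ _ Gs Gr); rewrite /= scaleN1r addNr normr0.
by rewrite mulN1r addrC subr_le0.
Qed.

(** One-dimensional extension: the value [c] at [y] must separate the numbers p.2 - |p.1 - y| from
    the numbers |q.1 + y| - q.2, and the supremum of the former does. *)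
Lemma dominated_graph_extend (G : set (X * R)) (y : X) :
  dominated_graph G -> G (0, 0) ->
  exists G', [/\ dominated_graph G', G `<=` G' & exists c, G' (y, c)].
Proof.
move=> [Glin Gle] G0.
have sub p q : G p -> G q -> p.2 - `|p.1 - y| <= `|q.1 + y| - q.2.
  move=> Gp Gq; have := Gle _ (Glin 1 _ _ Gp Gq); rewrite /= scale1r mul1r => pq.
  have := ler_normD (p.1 - y) (q.1 + y); rewrite addrACA addNr addr0 => tr.
  by lra.
pose S := [set p.2 - `|p.1 - y| | p in G].
have S0 : S !=set0 by exists (0 - `|0 - y|), (0, 0).
have Sub q : G q -> ubound S (`|q.1 + y| - q.2).
  by move=> Gq _ [p Gp <-]; exact: sub.
pose c := sup S.
have c1 p : G p -> p.2 - c <= `|p.1 - y|.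
  move=> Gp; have : p.2 - `|p.1 - y| <= c.
    by apply: ub_le_sup; [exists (`|0 + y| - 0); exact: (Sub (0, 0))|exists p].
  by lra.
have c2 p : G p -> p.2 + c <= `|p.1 + y|.
  by move=> Gp; have : c <= `|p.1 + y| - p.2 by [apply: ge_sup => //; exact: Sub]; lra.
have Gsc a p : G p -> G (a *: p.1, a * p.2).
  by move=> Gp; have := Glin a _ _ Gp G0; rewrite /= !addr0.
exists [set q | exists2 p, G p & exists s, q = (p.1 + s *: y, p.2 + s * c)].
split; first split.
- move=> a _ _ [p Gp [s ->]] [q Gq [t ->]] /=.
  exists (a *: p.1 + q.1, a * p.2 + q.2); first exact: Glin.
  exists (a * s + t) => /=; congr pair.
    by rewrite scalerDr scalerDl scalerA addrACA.
  by lra.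
- move=> _ [p Gp [s ->]] /=.
  (* Dividing by |s| reduces to s = -1, which is [c1], or s = 1, which is [c2]. *)
  have [s0|s0|->] := ltgtP s 0; last by rewrite scale0r mul0r !addr0 Gle.
  + have n0 : 0 < - s by rewrite oppr_gt0.
    have -> : p.1 + s *: y = (- s) *: ((- s)^-1 *: p.1 - y).
      by rewrite scalerBr scalerA mulfV ?gt_eqF// scale1r scaleNr opprK.
    rewrite normrZ gtr0_norm// -ler_pdivrMl// mulrDr.
    have -> : (- s)^-1 * (s * c) = - c.
      by rewrite mulrA invrN mulNr mulVf ?lt_eqF// mulN1r.
    exact: (c1 _ (Gsc (- s)^-1 _ Gp)).
  + have -> : p.1 + s *: y = s *: (s^-1 *: p.1 + y).
      by rewrite scalerDr scalerA mulfV ?gt_eqF// scale1r.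
    rewrite normrZ gtr0_norm// -ler_pdivrMl// mulrDr mulKf ?gt_eqF//.
    exact: (c2 _ (Gsc s^-1 _ Gp)).
- by move=> p Gp; exists p => //; exists 0; rewrite scale0r mul0r !addr0 -surjective_pairing.
- by exists c, (0,0) => //; exists 1; rewrite scale1r mul1r !add0r.
Qed.

(** A maximal dominated graph through (u, |u|) is everywhere defined; scaling its functional by |u|
    gives an element of the duality map at [u]. *)
Lemma norming_functional (u : X) : exists2 f : dual X, `|f| = `|u| & f u = `|u| ^+ 2.
Proof.
(* [P] admits the empty graph, the union of the empty chain. A maximal graph is nonempty, since
   otherwise the line through (u, |u|) would extend it. *)
pose P (G : set (X * R)) := dominated_graph G /\ (G !=set0 -> G (u, `|u|)).
have [|G [[dG Gu] Gmax]] := @Zorn_bigcup _ P.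
  move=> F FP Ftot; split; first split.
  - move=> a p q [G FG Gp] [H FH Hq].
    have [GH|HG] := Ftot _ _ FG FH.
      exists H => //; have [[+ _] _] := FP _ FH; apply => //; exact: GH.
    exists G => //; have [[+ _] _] := FP _ FG; apply => //; exact: HG.
  - by move=> p [G FG Gp]; have [[_ +] _] := FP _ FG; apply.
  - move=> [p [G FG Gp]]; exists G => //; have [_ +] := FP _ FG; apply; by exists p.
have Gn0 : G !=set0.
  apply: contrapT => /set0P/negP; rewrite negbK => /eqP G0.
  apply: (Gmax [set (a *: u, a * `|u|) | a in [set: R]]); last split.
  - rewrite G0; split => // /(_ (0 *: u, 0 * `|u|)); apply; by exists 0.
  - split => [a _ _ [b _ <-] [d _ <-]|_ [a _ <-]] /=.
      by exists (a * b + d) => //; rewrite scalerDl scalerA mulrDl mulrA.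
    by rewrite normrZ ler_wpM2r// ler_norm.
  - by move=> _; exists 1 => //; rewrite scale1r mul1r.
have {Gu} Gu := Gu Gn0.
have [Glin Gle] := dG.
have G0 : G (0, 0) by have := Glin (-1) _ _ Gu Gu; rewrite /= scaleN1r mulN1r !addNr.
have Gtot y : exists c, G (y, c).
  have [G' [dG' GG' [c G'y]]] := dominated_graph_extend y dG G0.
  apply: contrapT => Gy; apply: (Gmax G').
    by split=> // G'G; apply: Gy; exists c; exact: G'G.
  by split=> // _; exact: GG'.
have [h hP] := choice Gtot.
have lh : linear h.
  move=> a x y; apply: (dominated_graph_val dG (hP _)).
  exact: (Glin a (x, h x) (y, h y)).
have hle x : `|h x| <= 1 * `|x|.
  rewrite mul1r ler_norml; apply/andP; split; last exact: (Gle (x, h x)).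
  have := Gle _ (Glin (-1) _ _ (hP x) G0).
  by rewrite /= !addr0 scaleN1r normrN mulN1r lerNl.
have hu : h u = `|u| by exact: (dominated_graph_val dG (hP _)).
have [f fh f1] := linear_bounded_dual ler01 lh hle.
have fu : (`|u| *: f) u = `|u| ^+ 2 by rewrite dual_scaleE fh hu expr2.
exists (`|u| *: f) => //; apply/eqP; rewrite eq_le; apply/andP; split.
  by rewrite normrZ normr_id ler_piMr.
have [->|u0] := eqVneq u 0; first by rewrite normr0.
by have := dual_app_le (`|u| *: f) u; rewrite fu expr2 ler_pM2r ?normr_gt0.
Qed.

End hahn_banach.

(** * Uniform convexity as a substitute for weak compactness *)

Section uniform_convexity.
Context {R : realType}.

Lemma norm_mid_le (V : normedModType R) (x y : V) :
  `|2^-1 *: (x + y)| <= (`|x| + `|y|) / 2.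
Proof.
rewrite normrZ gtr0_norm ?invr_gt0// mulrC ler_wpM2r ?invr_ge0//.
exact: ler_normD.
Qed.

Lemma norm_mid_sqr_le (V : normedModType R) (x y : V) :
  `|2^-1 *: (x + y)| ^+ 2 <= (`|x| ^+ 2 + `|y| ^+ 2) / 2.
Proof.
have := norm_mid_le x y; have := normr_ge0 (2^-1 *: (x + y)).
move: (`|2^-1 *: (x + y)|) (`|x|) (`|y|) => m a b m0 mab.
have : m ^+ 2 <= ((a + b) / 2) ^+ 2 by rewrite ler_sqr// nnegrE; lra.
by have := sqr_ge0 (a - b); nra.
Qed.

(* Either the norms of x and y differ by at least d e / 4, and the defect comes
   from the strict convexity of the square, or uniform convexity applies after
   rescaling by the larger norm. *)
Lemma uniformly_convex_sqr (V : normedModType R) : uniformly_convex V ->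
  forall M e : R, 0 < e -> exists2 d : R, 0 < d & forall x y : V,
    `|x| <= M -> `|y| <= M -> e <= `|x - y| ->
    `|2^-1 *: (x + y)| ^+ 2 + d <= (`|x| ^+ 2 + `|y| ^+ 2) / 2.
Proof.
move=> ucV M e e0.
have [M0|M0] := leP M 0.
  exists 1 => // x y xM yM exy.
  have x0 : x = 0 by apply/eqP; rewrite -normr_le0 (le_trans xM).
  have y0 : y = 0 by apply/eqP; rewrite -normr_le0 (le_trans yM).
  by move: exy; rewrite x0 y0 subr0 normr0 leNgt e0.
have [d d0 dP] := ucV (e / M) (divr_gt0 e0 M0).
(* With a = |x| >= b = |y|, the first term bounds (a - b)^2 / 4 from below when a - b >= d e / 4;
   the second bounds d a (a - e / 4) from below, using a >= e / 2. *)
exists (Num.min ((d * e / 4) ^+ 2 / 4) (e / 2 * (e * d / 4))).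
  by rewrite lt_min !(mulr_gt0, exprn_gt0)// ?invr_gt0.
move=> x y; wlog xy : x y / `|y| <= `|x|.
  move=> wl xM yM exy; have [yx|/ltW yx] := leP `|y| `|x|; first exact: wl.
  by rewrite [x + y]addrC [`|x| ^+ 2 + _]addrC; apply: wl => //; rewrite distrC.
move=> xM yM exy.
have x0 : e / 2 <= `|x|.
  have := le_trans exy (ler_normB x y); lra.
have xp : 0 < `|x| by lra.
have [big|small] := leP (d * e / 4) (`|x| - `|y|).
  apply: (@le_trans _ _ (((`|x| + `|y|) / 2) ^+ 2 + (d * e / 4) ^+ 2 / 4)).
    apply: lerD; last by rewrite ge_min lexx.
    by rewrite ler_sqr ?nnegrE ?divr_ge0 ?addr_ge0 ?norm_mid_le.
  have : (d * e / 4) ^+ 2 <= (`|x| - `|y|) ^+ 2.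
    have k0 : 0 <= d * e / 4 by rewrite !mulr_ge0 ?invr_ge0// ltW.
    by rewrite ler_sqr ?nnegrE// (le_trans k0 big).
  by move: (`|x|) (`|y|) (d * e / 4) => a b k; nra.
have mid : `|2^-1 *: (x + y)| <= `|x| * (1 - d).
  have -> : 2^-1 *: (x + y) = `|x| *: (2^-1 *: (`|x|^-1 *: x + `|x|^-1 *: y)).
    by rewrite -scalerDr !scalerA mulrCA mulfV ?gt_eqF// mulr1.
  rewrite normrZ normr_id ler_wpM2l//; apply: dP.
  - by rewrite normrZ normfV normr_id mulVf// gt_eqF.
  - by rewrite normrZ normfV normr_id mulrC ler_pdivrMr// mul1r.
  - rewrite -scalerBr normrZ normfV normr_id mulrC.
    by apply: ler_pM; rewrite ?invr_ge0 ?lef_pV2 ?posrE// ltW.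
apply: (@le_trans _ _ (`|x| ^+ 2 * (1 - d) + e / 2 * (e * d / 4))).
  apply: lerD; last by rewrite ge_min lexx orbT.
  move: (normr_ge0 (2^-1 *: (x + y))) mid xp.
  move: (`|2^-1 *: (x + y)|) (`|x|) => m a m0 ma a0.
  have d1 : d <= 1 by nra.
  have : m ^+ 2 <= (a * (1 - d)) ^+ 2 by rewrite ler_sqr// nnegrE; nra.
  by nra.
move: (normr_ge0 y) xp x0 small xy {mid xM yM}.
move: (`|x|) (`|y|) => a b b0 a0 ae ab ba.
have h1 : b ^+ 2 >= a ^+ 2 - 2 * a * (d * e / 4).
  have : 0 <= (a - b) ^+ 2 by exact: sqr_ge0.
  by nra.
have : e / 2 * (e * d / 4) <= a * (e * d / 4).
  by rewrite ler_wpM2r// !mulr_ge0 ?invr_ge0// ltW.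
have : 0 <= d * a * (a - e / 2).
  by rewrite !mulr_ge0 ?subr_ge0// ltW.
by nra.
Qed.

(** If two terms of the tail stayed e apart, [uniformly_convex_sqr] would keep their midpoint defect
    above a fixed d > 0. The hypothesis is the form in which minimizing sequences supply small
    defects. *)
Lemma uniformly_convex_cvg (V : completeNormedModType R) (u : nat -> V) (M K : R) :
  uniformly_convex V -> (forall n, `|u n| <= M) ->
  (forall N m n, (N <= m)%N -> (N <= n)%N ->
    (`|u m| ^+ 2 + `|u n| ^+ 2) / 2 <= `|2^-1 *: (u m + u n)| ^+ 2 + K * N.+1%:R^-1) ->
  exists l : V, u @ \oo --> l.
Proof.
move=> ucV uM uK; apply/cvg_ex/cauchy_cvgP/cauchyP => e e0.
have [d d0 dP] := uniformly_convex_sqr ucV M e0.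
have [N NP] : exists N : nat, K * N.+1%:R^-1 < d.
  have KN : (fun n : nat => K * n.+1%:R^-1) @ \oo --> K * 0.
    by apply: cvgM; [exact: cvg_cst|exact: cvg_harmonic].
  rewrite mulr0 in KN.
  have [N _ NP] := (@cvgr_lt _ _ _ _ _ _ KN) _ d0.
  by exists N; exact: (NP N (leqnn _)).
exists (u N); exists N => // n /= Nn; rewrite -ball_normE/= ltNge; apply/negP => enn.
have := le_trans (dP _ _ (uM N) (uM n) enn) (uK N N n (leqnn _) Nn).
by rewrite lerD2l leNgt NP.
Qed.

(* Reflexivity of uniformly convex spaces, in the form of Smulian's
   characterization. *)
Lemma nested_convex_nonempty (V : completeNormedModType R) (C : R -> set V) (M : R) :
  uniformly_convex V ->
  (forall e, 0 < e -> C e !=set0) ->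
  (forall e, 0 < e -> closed (C e)) ->
  (forall e a b, 0 < e -> C e a -> C e b -> C e (2^-1 *: (a + b))) ->
  (forall d e, 0 < d -> d <= e -> C d `<=` C e) ->
  (forall e a, 0 < e -> C e a -> `|a| <= M) ->
  exists a, forall e, 0 < e -> C e a.
Proof.
move=> ucV C0 Ccl Cmid Cmono CM.
(* The supremum [m] of [S] is the limit, as e tends to 0, of the distance from 0 to [C e]. *)
pose S := [set r : R | exists2 e, 0 < e & forall a, C e a -> r <= `|a|].
have S0 : S 0 by exists 1.
have Sub : has_ubound S.
  exists M => r [e e0 er]; have [a Ca] := C0 _ e0.
  exact: le_trans (er _ Ca) (CM _ _ e0 Ca).
pose m := sup S.
have m0 : 0 <= m by exact: ub_le_sup.
have h0 n : 0 < n.+1%:R^-1 :> R by rewrite invr_gt0 ltr0n.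
have low (n : nat) : exists2 e, 0 < e & forall a, C e a -> m - n.+1%:R^-1 <= `|a|.
  have [|r [e e0 er] mr] := @sup_adherent _ S n.+1%:R^-1 (h0 n).
    by split => //; exists 0.
  by exists e => // a /er; apply: le_trans; exact: ltW.
have up (n : nat) (e : R) : 0 < e -> exists2 a, C e a & `|a| <= m + n.+1%:R^-1.
  move=> e0; apply: contrapT => H.
  suff : S (m + n.+1%:R^-1) by move=> /(ub_le_sup Sub); rewrite gerDl leNgt h0.
  exists e => // a Ca; rewrite leNgt; apply/negP => /ltW ah.
  by apply: H; exists a.
(* A midpoint of two chosen points lies in the larger of their two sets, so its norm cannot drop
   much below [m]. *)
have /choice[ea eaP] (n : nat) : exists p : R * V, [/\ 0 < p.1, p.1 <= n.+1%:R^-1,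
    (forall a, C p.1 a -> m - n.+1%:R^-1 <= `|a|), C p.1 p.2 &
    `|p.2| <= m + n.+1%:R^-1].
  have [e e0 eP] := low n.
  pose e' := Num.min e n.+1%:R^-1.
  have e'0 : 0 < e' by rewrite lt_min e0 h0.
  have [a Ca am] := up n _ e'0.
  exists (e', a); split => //=; first by rewrite ge_min lexx orbT.
  by move=> b /(Cmono e' e e'0) Cb; apply: eP; apply: Cb; rewrite ge_min lexx.
have hle (N n : nat) : (N <= n)%N -> n.+1%:R^-1 <= N.+1%:R^-1 :> R.
  by move=> Nn; rewrite lef_pV2 ?posrE ?ltr0n// ler_nat.
have h1 (n : nat) : n.+1%:R^-1 <= 1 :> R by have := hle 0 n isT; rewrite invr1.
pose u n := (ea n).2.
(* With h = 1 / (N + 1) <= 1, the defect is at most (m + h)^2 - (m^2 - 2 m h) = 4 m h + h^2 <= (4 m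
   + 1) h. *)
have [||l ul] := @uniformly_convex_cvg V u (m + 1) (4 * m + 1) ucV.
- by move=> n; have [_ _ _ _ /le_trans] := eaP n; apply; rewrite lerD2l.
- move=> N i j Ni Nj.
  have [ei0 eih ilow Ci uih] := eaP i; have [ej0 ejh jlow Cj ujh] := eaP j.
  have : m - N.+1%:R^-1 <= `|2^-1 *: (u i + u j)|.
    have [eij|/ltW eji] := leP (ea i).1 (ea j).1.
      apply: (@le_trans _ _ (m - j.+1%:R^-1)); first by rewrite lerB// hle.
      by apply: jlow; apply: Cmid => //; exact: (Cmono _ _ ei0 eij).
    apply: (@le_trans _ _ (m - i.+1%:R^-1)); first by rewrite lerB// hle.
    by apply: ilow; apply: Cmid => //; exact: (Cmono _ _ ej0 eji).
  have : `|u i| <= m + N.+1%:R^-1 by rewrite (le_trans uih)// lerD2l hle.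
  have : `|u j| <= m + N.+1%:R^-1 by rewrite (le_trans ujh)// lerD2l hle.
  move: (normr_ge0 (u i)) (normr_ge0 (u j)) (h0 N) (h1 N).
  move: (`|u i|) (`|u j|) (`|2^-1 *: (u i + u j)|) (N.+1%:R^-1) => a b c h.
  move=> a0 b0 hp hh bm am mc.
  have : a ^+ 2 <= (m + h) ^+ 2 by rewrite ler_sqr// nnegrE; lra.
  have : b ^+ 2 <= (m + h) ^+ 2 by rewrite ler_sqr// nnegrE; lra.
  have : m ^+ 2 - 2 * m * h <= c ^+ 2.
    have : 0 <= (c - m) ^+ 2 by exact: sqr_ge0.
    have : 0 <= m * (c - (m - h)) by rewrite mulr_ge0// subr_ge0.
    by nra.
  by nra.
exists l => e e0; apply: (closed_cvg _ (Ccl e e0) _ _ ul).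
apply: filterS ((@cvgr_lt _ _ _ _ _ _ (@cvg_harmonic R)) _ e0) => n /= hn.
have [en0 enh _ Cn _] := eaP n.
by apply: (Cmono _ _ en0 _ _ Cn); rewrite (le_trans enh)// ltW.
Qed.

Lemma min_norm_exists (V : completeNormedModType R) (C : set V) :
  uniformly_convex V -> C !=set0 -> closed C ->
  (forall a b, C a -> C b -> C (2^-1 *: (a + b))) ->
  exists2 a, C a & forall b, C b -> `|a| <= `|b|.
Proof.
move=> ucV [a0 Ca0] Ccl Cmid.
pose m := inf [set `|a| | a in C].
have mlb a : C a -> m <= `|a|.
  by move=> Ca; apply: ge_inf; [exists 0 => _ [b _ <-]|exists a].
(* The cap m + 1 provides the bound uniform in e that [nested_convex_nonempty] requires. *)
pose D e := C `&` [set a | `|a| <= Num.min (m + e) (m + 1)].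
have [|||||a Da] := @nested_convex_nonempty V D (m + 1) ucV.
- move=> e e0.
  have [||_ [a Ca <-] am] := @inf_adherent _ [set `|a| | a in C] (Num.min e 1).
  + by rewrite lt_min e0 ltr01.
  + by split; [exists `|a0|, a0|exists 0 => _ [b _ <-]].
  + exists a; split => //=; move: am; rewrite -/m le_min => /ltW am.
    by rewrite !(le_trans am)// lerD2l ge_min lexx ?orbT.
- move=> e e0; apply: closedI => //.
  apply: (preimage_closed _ (@closed_le _ _)) => y _; exact: norm_continuous.
- move=> e a b e0 [Ca al] [Cb bl]; split; first exact: Cmid.
  by rewrite /= (le_trans (norm_mid_le _ _))//; move: al bl => /=; lra.
- move=> d e d0 de a [Ca am]; split => //; move: am => /=; rewrite !le_min => /andP[ad ->].
  by rewrite (le_trans ad)// lerD2l.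
- by move=> e a e0 [_]; rewrite /= le_min => /andP[].
have [Ca _] := Da _ ltr01; exists a => // b Cb.
apply/ler_addgt0Pr => e e0; have [_] := Da _ e0; rewrite /= le_min => /andP[/le_trans ae _].
by apply: ae; rewrite lerD2r mlb.
Qed.

End uniform_convexity.

(** * Duality maps and derivatives of the squared norms *)

Section duality_maps.
Context {R : realType}.

(** The slices f a >= |f| - e of the unit ball are nested, closed and convex; a common point attains
    the norm and is then scaled by |f|. *)
Lemma norm_attained (X : completeNormedModType R) (f : dual X) :
  uniformly_convex X -> exists2 p : X, `|p| = `|f| & f p = `|f| ^+ 2.
Proof.
move=> ucX.
pose C (e : R) := [set a : X | `|a| <= 1] `&` [set a | `|f| - e <= f a].
have [|||||a aC] := @nested_convex_nonempty R X C 1 ucX.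
- move=> e e0.
  have [_ [a a1 <-] fa] := sup_adherent e0 (dual_has_sup f).
  have [fa0|fa0] := leP 0 (f a).
    by exists a; split => //=; rewrite ltW// -(ger0_norm fa0).
  exists (- a); split; rewrite /= ?normrN// dual_appN ltW//.
  by rewrite -(ltr0_norm fa0).
- move=> e e0; apply: closedI.
    apply: (preimage_closed _ (@closed_le _ _)) => y _; exact: norm_continuous.
  apply: (preimage_closed _ (@closed_ge _ _)) => y _; exact: dual_continuous.
- move=> e a b e0 [/= a1 fa] [/= b1 fb]; split => /=.
    by rewrite (le_trans (norm_mid_le _ _))//; lra.
  by rewrite !dualE; lra.
- move=> d e d0 de a [a1 /= fa]; split => //=; lra.
- by move=> e a e0 [].
have a1 : `|a| <= 1 by have [] := aC _ ltr01.
have fa : f a = `|f|.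
  apply/eqP; rewrite eq_le; apply/andP; split.
    by rewrite (le_trans (dual_app_le _ _))// ler_piMr.
  by apply/ler_addgt0Pr => e /aC[_ /=]; rewrite lerBlDr.
exists (`|f| *: a); last by rewrite dual_appZ fa expr2.
rewrite normrZ normr_id; have [->|f0] := eqVneq f 0; first by rewrite normr0 mul0r.
apply/eqP; rewrite eq_le ler_piMr//=.
by rewrite -{1}fa dual_app_le.
Qed.

(* The supporting element q of v + s h nearly supports v, hence lies close to w
   by uniform convexity; and |v + s h|^2 / 2 <= |v|^2 / 2 + s B h q. *)
Lemma norm_sqr_derivative (V W : normedModType R) (B : V -> W -> R) :
  uniformly_convex W ->
  (forall w, linear (B^~ w)) -> (forall v, linear (B v)) ->
  (forall v w, B v w <= `|v| * `|w|) ->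
  (forall v, exists2 w, `|w| = `|v| & B v w = `|v| ^+ 2) ->
  forall v, exists w, [/\ `|w| = `|v|, B v w = `|v| ^+ 2 &
    forall (h : V) (e : R), 0 < e -> exists2 d : R, 0 < d &
      forall s, 0 < s -> s <= d ->
        `|v + s *: h| ^+ 2 / 2 <= `|v| ^+ 2 / 2 + s * (B h w + e)].
Proof.
move=> ucW lB1 lB2 Ble supp v; have [w wv Bvw] := supp v.
exists w; split => // h e e0.
have B0 v' : B v' 0 = 0.
  by have := lB2 v' (-1) 0 0; rewrite scaler0 addr0 scaleN1r addNr.
have B2D v' w1 w2 : B v' (w1 + w2) = B v' w1 + B v' w2.
  by have := lB2 v' 1 w1 w2; rewrite !scale1r.
have B2Z v' a w1 : B v' (a *: w1) = a * B v' w1.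
  by have := lB2 v' a w1 0; rewrite B0 !addr0.
pose M := `|v| + `|h|.
have M0 : 0 <= M by rewrite addr_ge0.
(* Once |q - w| is below this bound, B h (q - w) <= |h| |q - w| <= e. *)
have e'0 : 0 < e / (`|h| + 1) by rewrite divr_gt0// ltr_wpDl.
have [d d0 dP] := uniformly_convex_sqr ucW M e'0.
have K0 : 0 < 2 * (`|h| * M) + 1 by rewrite ltr_wpDl// !mulr_ge0.
(* If q and w were farther apart than that, their midpoint defect would be at least d but at most 2
   s |h| M; this bound on s makes the latter smaller than d. *)
exists (Num.min 1 (d / (2 * (`|h| * M) + 1) / 2)).
  by rewrite lt_min ltr01 !divr_gt0.
move=> s s0; rewrite le_min => /andP[s1 sd].
have [q qv Bq] := supp (v + s *: h).
have Bvhq : B (v + s *: h) q = B v q + s * B h q.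
  by rewrite addrC (lB1 q s h v) addrC.
have shM : `|s *: h| = s * `|h| by rewrite normrZ gtr0_norm.
have sh_le : s * `|h| <= `|h| by rewrite ler_piMl.
have qM : `|q| <= M.
  by rewrite qv (le_trans (ler_normD _ _))// lerD2l shM.
have vq : `|v| - `|q| <= s * `|h|.
  rewrite qv -shM lerBlDr -{1}(addrK (s *: h) v).
  by rewrite (le_trans (ler_normB _ _))// addrC.
have Bhq : B h q <= `|h| * M by rewrite (le_trans (Ble _ _))// ler_wpM2l.
have Bvq : `|q| ^+ 2 - s * (`|h| * M) <= B v q.
  rewrite {1}qv -Bq Bvhq.
  have : s * B h q <= s * (`|h| * M) by rewrite ler_wpM2l// ltW.
  lra.
have qw : `|q - w| < e / (`|h| + 1).
  rewrite ltNge; apply/negP => eqw.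
  have wM : `|w| <= M by rewrite wv lerDl.
  have := dP _ _ qM wM eqw.
  have := Ble v (2^-1 *: (q + w)); rewrite B2Z B2D Bvw.
  have sK : 2 * (s * `|h| * M) < d.
    move: sd; rewrite -mulrA -invfM ler_pdivlMr ?mulr_gt0// => sd.
    by nra.
  have sh0 : 0 <= s * `|h| by rewrite mulr_ge0// ltW.
  move: wM vq Bvq sK sh0; rewrite wv [s * (`|h| * M)]mulrA; move: qM (normr_ge0 v) (normr_ge0 q).
  move: (B v q) (`|v|) (`|q|) (`|2^-1 *: (q + w)|) (s * `|h|).
  move=> z a b c k bM a0 b0 aM abk zb kd k0 zc cd.
  have : 0 <= (k - (a - b)) * (a + b) by rewrite mulr_ge0 ?subr_ge0 ?addr_ge0.
  have : 0 <= k * (2 * M - a - b) by rewrite mulr_ge0//; lra.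
  have := sqr_ge0 (c - a).
  by nra.
have Bhqw : B h q <= B h w + e.
  have -> : B h q = B h w + B h (q - w) by rewrite -B2D addrC subrK.
  rewrite lerD2l (le_trans (Ble _ _))//.
  move/ltW: qw; rewrite ler_pdivlMr; last by rewrite ltr_wpDl.
  by apply: le_trans; rewrite mulrC ler_wpM2l// lerDl.
apply: (@le_trans _ _ (`|v| ^+ 2 / 2 + s * B h q)).
  move: Bq; rewrite Bvhq -qv; have := Ble v q; have := sqr_ge0 (`|v| - `|q|).
  move: (B v q) (`|v|) (`|q|) (s * B h q) => z a b k; nra.
by rewrite lerD2l ler_wpM2l// ltW.
Qed.

(** Here f is J u, the derivative of half the squared norm; the upper estimate for s > 0 is what a
    minimizer is tested with. *)
Lemma primal_derivative (X : normedModType R) (u : X) : uniformly_convex (dual X) ->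
  exists f : dual X, [/\ `|f| = `|u|, f u = `|u| ^+ 2 &
    forall (h : X) (e : R), 0 < e -> exists2 d : R, 0 < d &
      forall s, 0 < s -> s <= d ->
        `|u + s *: h| ^+ 2 / 2 <= `|u| ^+ 2 / 2 + s * (f h + e)].
Proof.
move=> ucX'; apply: (@norm_sqr_derivative X (dual X) (fun x f => f x)) => //.
- by move=> f; exact: dual_linear.
- by move=> x f; rewrite mulrC dual_app_le.
- exact: norming_functional.
Qed.

Lemma dual_derivative (X : completeNormedModType R) (f : dual X) : uniformly_convex X ->
  exists q : X, [/\ `|q| = `|f|, f q = `|f| ^+ 2 &
    forall (h : dual X) (e : R), 0 < e -> exists2 d : R, 0 < d &
      forall s, 0 < s -> s <= d ->
        `|f + s *: h| ^+ 2 / 2 <= `|f| ^+ 2 / 2 + s * (h q + e)].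
Proof.
move=> ucX; apply: (@norm_sqr_derivative (dual X) X (fun f x => f x)) => //.
- by move=> g; exact: dual_linear.
- by move=> x g; exact: dual_app_le.
- by move=> g; exact: norm_attained.
Qed.

End duality_maps.

(** * Fitzpatrick functions and surjectivity of A + J *)

Section monotone_operators.
Context {R : realType}.

Definition monotonically_related (X : normedModType R) (A : X -> set (dual X))
    (p : X) (a : dual X) : Prop :=
  forall y y', A y y' -> 0 <= (a - y') (p - y).

(** Otherwise adjoining (p, a) to the graph would give a proper monotone extension. *)
Lemma maximal_monotone_related (X : normedModType R) (A : X -> set (dual X)) :
  maximal_monotone A -> forall p a, monotonically_related A p a -> A p a.
Proof.
move=> [mA maxA] p a pa; apply: contrapT => nApa.
pose B x := A x `|` [set x' | x = p /\ x' = a].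
apply: (maxA B).
  move=> x y x' y' [Ax|[-> ->]] [Ay|[-> ->]].
  - exact: mA.
  - by have := pa _ _ Ax; rewrite !dualE; lra.
  - exact: pa.
  - by rewrite !subrr dual_app0.
split; first by move=> [x x'] /= Ax; left.
by move=> /(_ (p, a)) BA; apply: nApa; apply: BA; right.
Qed.

(* [fitzpatrick_epi A u f c] says that the Fitzpatrick function of A at (u, f)
   is at most c. *)
Definition fitzpatrick_epi (X : normedModType R) (A : X -> set (dual X))
    (u : X) (f : dual X) (c : R) : Prop :=
  forall y y', A y y' -> y' u + f y - y' y <= c.

(** On the graph, the pair (u, f) itself gives the bound. Off the graph, maximality yields (y, y')
    with (f - y') (u - y) < 0, so its affine term exceeds f u. *)
Lemma fitzpatrick_ge (X : normedModType R) (A : X -> set (dual X)) u f c :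
  maximal_monotone A -> fitzpatrick_epi A u f c -> f u <= c.
Proof.
move=> mA Fc; have [Auf|nAuf] := pselect (A u f).
  by have := Fc _ _ Auf; lra.
have : ~ monotonically_related A u f.
  by move=> /(maximal_monotone_related mA).
move=> /existsNP[y /existsNP[y' /not_implyP[Ay /negP]]].
by rewrite -ltNge !dualE; have := Fc _ _ Ay; lra.
Qed.

(** A supremum of affine functions is convex; writing the segment from its starting point fits the
    directional derivatives. *)
Lemma fitzpatrick_convex (X : normedModType R) (A : X -> set (dual X))
    u1 f1 c1 u2 f2 c2 (s : R) : 0 <= s -> s <= 1 ->
  fitzpatrick_epi A u1 f1 c1 -> fitzpatrick_epi A u2 f2 c2 ->
  fitzpatrick_epi A (u1 + s *: (u2 - u1)) (f1 + s *: (f2 - f1))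
    (c1 + s * (c2 - c1)).
Proof.
move=> s0 s1 F1 F2 y y' Ay; rewrite !dualE.
have := F1 _ _ Ay; have := F2 _ _ Ay => h1 h2.
have : 0 <= s * (c2 - (y' u2 + f2 y - y' y)) by rewrite mulr_ge0// subr_ge0.
have : 0 <= (1 - s) * (c1 - (y' u1 + f1 y - y' y)) by rewrite mulr_ge0// subr_ge0.
by nra.
Qed.

Lemma fitzpatrick_graph (X : normedModType R) (A : X -> set (dual X)) y y' :
  Defs.monotone A -> A y y' -> fitzpatrick_epi A y y' (y' y).
Proof. by move=> mA Ay z z' Az; have := mA _ _ _ _ Ay Az; rewrite !dualE; lra. Qed.

(** The objective is nonnegative because c >= f u >= - |u| |f|. Convexity of the Fitzpatrick
    function makes the midpoint defects of a minimizing sequence small, so both components converge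
    in norm. *)
Lemma fitzpatrick_minimizer (X : completeNormedModType R) (A : X -> set (dual X)) :
  uniformly_convex X -> uniformly_convex (dual X) -> maximal_monotone A ->
  (exists x, dom A x) ->
  exists u f c, fitzpatrick_epi A u f c /\
    forall u1 f1 c1, fitzpatrick_epi A u1 f1 c1 ->
      c + `|u| ^+ 2 / 2 + `|f| ^+ 2 / 2 <= c1 + `|u1| ^+ 2 / 2 + `|f1| ^+ 2 / 2.
Proof.
move=> ucX ucX' mA [y0 [y0' Ay0]].
pose val (p : X * dual X * R) := p.2 + `|p.1.1| ^+ 2 / 2 + `|p.1.2| ^+ 2 / 2.
pose E := [set p : X * dual X * R | fitzpatrick_epi A p.1.1 p.1.2 p.2].
pose S := [set val p | p in E].
have val0 p : E p -> 0 <= val p.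
  move=> /(fitzpatrick_ge mA); have := dual_app_ge p.1.2 p.1.1.
  have := sqr_ge0 (`|p.1.1| - `|p.1.2|); rewrite /val.
  move: (p.1.2 p.1.1) p.2 (`|p.1.1|) (`|p.1.2|) => a b c d; nra.
have Sinf : has_inf S.
  split; last by exists 0 => _ [p Ep <-]; exact: val0.
  by exists (val (y0, y0', y0' y0)), (y0, y0', y0' y0) => //; exact: fitzpatrick_graph mA.1 Ay0.
pose m := inf S.
have mle p : E p -> m <= val p.
  by move=> Ep; apply: ge_inf; [exact: Sinf.2|exists p].
have h0 (n : nat) : 0 < n.+1%:R^-1 :> R by rewrite invr_gt0 ltr0n.
have hle (N n : nat) : (N <= n)%N -> n.+1%:R^-1 <= N.+1%:R^-1 :> R.
  by move=> Nn; rewrite lef_pV2 ?posrE ?ltr0n// ler_nat.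
have h1 (n : nat) : n.+1%:R^-1 <= 1 :> R by have := hle 0 n isT; rewrite invr1.
have /choice[w wP] (n : nat) : exists p, E p /\ val p <= m + n.+1%:R^-1.
  have [_ [p Ep <-] /ltW pm] := inf_adherent (h0 n) Sinf.
  by exists p.
(* Testing the epigraph condition at (y0, y0') and completing squares gives (|u| - a)^2 / 2 + (|f| -
   b)^2 / 2 <= K along the sequence. *)
pose a := `|y0'|; pose b := `|y0|; pose K := m + 1 + y0' y0 + a ^+ 2 / 2 + b ^+ 2 / 2.
have bnd n : `|(w n).1.1| <= a + 1 + 2 * K /\ `|(w n).1.2| <= b + 1 + 2 * K.
  have [En vn] := wP n; have := En _ _ Ay0.
  have := dual_app_ge y0' (w n).1.1; have := dual_app_ge (w n).1.2 y0.
  rewrite -/a -/b => e1 e2 e3.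
  have : val (w n) <= m + 1 by rewrite (le_trans vn)// lerD2l.
  rewrite /val /K; move: e1 e2 e3 => {vn En}.
  move: (normr_ge0 (w n).1.1) (normr_ge0 (w n).1.2).
  move: (y0' (w n).1.1) (y0' y0) ((w n).1.2 y0) (`|(w n).1.1|) (`|(w n).1.2|) (w n).2 => r1 r2 r3 u f c.
  move=> u0 f0 e1 e2 e3 e4.
  have hK : (u - a) ^+ 2 / 2 + (f - b) ^+ 2 / 2 <= m + 1 + r2 + a ^+ 2 / 2 + b ^+ 2 / 2.
    by nra.
  by have := sqr_ge0 (u - a - 1); have := sqr_ge0 (f - b - 1);
     have := sqr_ge0 (u - a); have := sqr_ge0 (f - b); split; nra.
(* Both defects are nonnegative and half their sum is at most 1 / (N + 1), since the midpoint has
   value at least [m]; hence the factor 2. *)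
have par N i j : (N <= i)%N -> (N <= j)%N ->
    (`|(w i).1.1| ^+ 2 + `|(w j).1.1| ^+ 2) / 2 <=
       `|2^-1 *: ((w i).1.1 + (w j).1.1)| ^+ 2 + 2 * N.+1%:R^-1 /\
    (`|(w i).1.2| ^+ 2 + `|(w j).1.2| ^+ 2) / 2 <=
       `|2^-1 *: ((w i).1.2 + (w j).1.2)| ^+ 2 + 2 * N.+1%:R^-1.
  move=> Ni Nj; have [Ei vi] := wP i; have [Ej vj] := wP j.
  have mid (V : lmodType R) (x y : V) : x + 2^-1 *: (y - x) = 2^-1 *: (x + y).
    have xE : x = 2^-1 *: x + 2^-1 *: x.
      by rewrite -scalerDl -[LHS]scale1r; congr (_ *: _); lra.
    by rewrite scalerBr [RHS]scalerDr {1}xE -addrA [X in _ + X]addrC subrK.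
  have h2 : 0 <= 2^-1 :> R by lra.
  have h21 : 2^-1 <= 1 :> R by lra.
  have := fitzpatrick_convex h2 h21 Ei Ej; rewrite (mid X) (mid (dual X)) => /(mle (_, _, _)).
  have : val (w i) <= m + N.+1%:R^-1 by rewrite (le_trans vi)// lerD2l hle.
  have : val (w j) <= m + N.+1%:R^-1 by rewrite (le_trans vj)// lerD2l hle.
  have := norm_mid_sqr_le (w i).1.1 (w j).1.1.
  have := norm_mid_sqr_le (w i).1.2 (w j).1.2.
  rewrite /val /=; move: (N.+1%:R^-1) => h.
  by split; lra.
have [|u wu] := @uniformly_convex_cvg R X (fun n => (w n).1.1) _ 2 ucX (fun n => (bnd n).1).
  by move=> N i j Ni Nj; have [] := par N i j Ni Nj.
have [|f wf] := @uniformly_convex_cvg R (dual X) (fun n => (w n).1.2) _ 2 ucX' (fun n => (bnd n).2).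
  by move=> N i j Ni Nj; have [] := par N i j Ni Nj.
(* This [c] gives the limit the value [m]; it is admissible because each affine inequality passes to
   the limit. *)
pose c := m - `|u| ^+ 2 / 2 - `|f| ^+ 2 / 2.
exists u, f, c; split; last first.
  move=> u1 f1 c1 F1; have := mle (u1, f1, c1) F1; rewrite /val /c /=; lra.
move=> y y' Ay.
have cy' : (fun n => y' (w n).1.1) @ \oo --> y' u.
  exact: (cvg_comp _ _ wu (@dual_continuous _ _ y' u)).
have cy : (fun n => (w n).1.2 y) @ \oo --> f y.
  exact: (cvg_comp _ _ wf (@dual_eval_continuous _ _ y f)).
have lhs : (fun n => y' (w n).1.1 + (w n).1.2 y - y' y) @ \oo --> y' u + f y - y' y.
  by apply: cvgB; [exact: cvgD|exact: cvg_cst].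
have rhs : (fun n => m + n.+1%:R^-1 - `|(w n).1.1| ^+ 2 / 2 - `|(w n).1.2| ^+ 2 / 2) @ \oo
    --> m + 0 - `|u| ^+ 2 / 2 - `|f| ^+ 2 / 2.
  apply: cvgB; first apply: cvgB; first apply: cvgD.
  - exact: cvg_cst.
  - exact: cvg_harmonic.
  - by apply: cvgM; [apply: cvgM; apply: cvg_norm|exact: cvg_cst].
  - by apply: cvgM; [apply: cvgM; apply: cvg_norm|exact: cvg_cst].
rewrite addr0 -/c in rhs.
apply: (ler_cvg_to lhs rhs); near=> n.
have [En vn] := wP n; have := En _ _ Ay; move: vn; rewrite /val /=.
by move: (n.+1%:R^-1) => h; lra.
Unshelve. all: by end_near. Qed.

(* Surjectivity of A + J (Rockafellar, Minty), after Simons and Zalinescu: the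
   derivative of the quadratic term at a minimizer (u, f) is (j, q) with j = J u
   and q the preimage of f under J, and (- q, - j) turns out to be
   monotonically related to A. *)
Lemma minty_rockafellar (X : completeNormedModType R) (A : X -> set (dual X)) :
  uniformly_convex X -> uniformly_convex (dual X) -> maximal_monotone A ->
  (exists x, dom A x) ->
  exists p a, [/\ A p a, `|a| = `|p| & a p = - `|p| ^+ 2].
Proof.
move=> ucX ucX' mA Ane.
have [u [f [c [Fc minF]]]] := fitzpatrick_minimizer ucX ucX' mA Ane.
have [j [ju jE jD]] := primal_derivative u ucX'.
have [q [qf qE qD]] := dual_derivative f ucX.
have fuc := fitzpatrick_ge mA Fc.
(* First-order condition at (u, f) along the segment towards (y, y'). *)
have opt y y' : A y y' -> c + `|u| ^+ 2 + `|f| ^+ 2 + j q <= (- j - y') (- q - y).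
  move=> Ay.
  suff : c <= y' y + j (y - u) + (y' - f) q by rewrite !dualE jE qE; lra.
  apply/ler_addgt0Pr => e e0; have e20 : 0 < e / 2 by rewrite divr_gt0.
  have [d1 d10 D1] := jD (y - u) _ e20.
  have [d2 d20 D2] := qD (y' - f) _ e20.
  pose s := Num.min 1 (Num.min d1 d2).
  have s0 : 0 < s by rewrite !lt_min ltr01 d10 d20.
  have s1 : s <= 1 by rewrite ge_min lexx.
  have sd1 : s <= d1 by rewrite !ge_min lexx orbT.
  have sd2 : s <= d2 by rewrite !ge_min lexx !orbT.
  have := minF _ _ _ (fitzpatrick_convex (ltW s0) s1 Fc (fitzpatrick_graph mA.1 Ay)).
  have := D1 _ s0 sd1; have := D2 _ s0 sd2.
  move: (j (y - u)) ((y' - f) q) (`|u + _|) (`|f + _|) => r1 r2 n1 n2 h1 h2 h3.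
  have : 0 <= s * (y' y + r1 + r2 + e - c) by nra.
  by rewrite pmulr_rge0// subr_ge0.
have jq := dual_app_ge j q; have fu := dual_app_ge f u.
have sq : (`|u| - `|f|) ^+ 2 <= c + `|u| ^+ 2 + `|f| ^+ 2 + j q.
  by move: jq fu; rewrite ju qf; move: fuc; move: (j q) (f u) (`|u|) (`|f|) => *; nra.
have Apa : A (- q) (- j).
  apply: maximal_monotone_related => // y y' /opt; apply: le_trans.
  by rewrite (le_trans _ sq)// sqr_ge0.
(* Testing the condition with the pair just found makes the right side 0 and forces equality in
   every estimate behind [sq]. *)
have := opt _ _ Apa; rewrite !subrr dual_app0 => le0.
have uf : `|u| = `|f|.
  apply/eqP; rewrite -subr_eq0 -sqrf_eq0 eq_le sqr_ge0 andbT.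
  exact: le_trans le0.
exists (- q), (- j); split => //; first by rewrite !normrN ju qf.
rewrite !dualE opprK normrN qf; apply/eqP; rewrite eq_le.
move: jq fu le0; rewrite ju qf uf => jq fu le0.
by apply/andP; split; nra.
Qed.

End monotone_operators.

(** * Resolvents with prescribed centre and parameter *)

Section resolvent.
Context {R : realType}.

Lemma related_maximal_monotone (X : normedModType R) (A : X -> set (dual X)) :
  Defs.monotone A -> (forall p a, monotonically_related A p a -> A p a) ->
  maximal_monotone A.
Proof.
move=> mA relA; split => // B mB [AB BA]; apply: BA => -[p a] /= Bpa.
by apply: relA => y y' /(AB (y, y')) /= By; exact: mB.
Qed.

(** With w = v + u and b = mu a, the problem becomes 0 in J u + B u for the maximal monotone
    operator B u = mu A (x + t (v + u)), solved by [minty_rockafellar]. *)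
Lemma resolvent_exists (X : completeNormedModType R) (A : X -> set (dual X))
    (x v : X) (t mu : R) :
  uniformly_convex X -> uniformly_convex (dual X) -> maximal_monotone A ->
  (exists y, dom A y) -> 0 < t -> 0 < mu ->
  exists w a, [/\ A (x + t *: w) a, `|w - v| = mu * `|a| &
    a (w - v) = - (mu * `|a| ^+ 2)].
Proof.
move=> ucX ucX' mA [y0 [y0' Ay0]] t0 mu0.
have tn0 : t != 0 by rewrite gt_eqF.
have mun0 : mu != 0 by rewrite gt_eqF.
pose B u : set (dual X) := [set b | A (x + t *: (v + u)) (mu^-1 *: b)].
have change y : x + t *: (v + (t^-1 *: (y - x) - v)) = y.
  by rewrite [v + _]addrC subrK scalerA mulfV// scale1r addrC subrK.
have diff p q : x + t *: (v + p) - (x + t *: (v + q)) = t *: (p - q).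
  by rewrite opprD addrACA subrr add0r -scalerBr opprD addrACA subrr add0r.
have scaled p q (p' q' : dual X) : 0 <= (mu^-1 *: p' - mu^-1 *: q')
      (x + t *: (v + p) - (x + t *: (v + q))) = (0 <= (p' - q') (p - q)).
  by rewrite -scalerBr diff dual_scaleE dual_appZ !pmulr_rge0 ?invr_gt0.
have mB : maximal_monotone B.
  apply: related_maximal_monotone => [p q p' q' Bp Bq|p b rel].
    by rewrite -scaled; exact: mA.1.
  apply: (maximal_monotone_related mA) => y y' Ay.
  rewrite -(change y) -[y'](scalerK mun0) scaled; apply: rel.
  by rewrite /B/= change scalerK.
have Bne : exists u, dom B u.
  exists (t^-1 *: (y0 - x) - v), (mu *: y0').
  by rewrite /B/= change scalerK.
have [p [b [Bpb bp bpE]]] := minty_rockafellar ucX ucX' mB Bne.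
have nb : mu * `|mu^-1 *: b| = `|p|.
  by rewrite normrZ gtr0_norm ?invr_gt0// mulVKf.
exists (v + p), (mu^-1 *: b); rewrite [v + p - v]addrC addKr; split => //.
rewrite dualE bpE -nb; move: nb; set n := `|mu^-1 *: b| => nb.
by rewrite exprMn mulrN [mu ^+ 2]expr2 -mulrA mulKf.
Qed.

End resolvent.

(** * Minimal-norm elements and limits of bounded elements *)

Section bounded_part.
Context {R : realType} (X : completeNormedModType R).
Variable A : X -> set (dual X).
Hypotheses (ucX' : uniformly_convex (dual X)) (mA : maximal_monotone A).

Lemma related_closed (p q : X) (y' : dual X) (r : R) :
  closed [set a : dual X | r <= (a - y') (p - q)].
Proof.
have -> : [set a : dual X | r <= (a - y') (p - q)] =
    [set a : dual X | r + y' (p - q) <= a (p - q)].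
  by apply/seteqP; split => a; rewrite /mkset dual_subE lerBrDr.
apply: (preimage_closed _ (@closed_ge _ _)) => y _; exact: dual_eval_continuous.
Qed.

Lemma related_mid (a b c : dual X) (z : X) (r : R) :
  r <= (a - c) z -> r <= (b - c) z -> r <= (2^-1 *: (a + b) - c) z.
Proof. by rewrite !dualE; lra. Qed.

(** By maximality [A y] is an intersection of closed half-spaces, so a least-norm element exists and
    [get] does not return its default value. *)
Lemma min_norm_selP (y : X) : dom A y ->
  A y (min_norm_sel A y) /\ forall y', A y y' -> `|min_norm_sel A y| <= `|y'|.
Proof.
move=> Dy.
have AyE : A y = \bigcap_(p in [set p | A p.1 p.2])
    [set a : dual X | 0 <= (a - p.2) (y - p.1)].
  apply/seteqP; split => [a Aya [z z'] /= Az|a Ha]; first exact: mA.1.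
  by apply: (maximal_monotone_related mA) => z z' Az; exact: (Ha (z, z')).
have [|| a Aa amin] := @min_norm_exists R (dual X) (A y) ucX' Dy.
- by rewrite AyE; apply: closed_bigI => p _; exact: related_closed.
- move=> a b Aa Ab; apply: (maximal_monotone_related mA) => z z' Az.
  by apply: related_mid; exact: mA.1.
exact: (@getPex _ [set x' | A y x' /\ forall y', A y y' -> `|x'| <= `|y'|]
  (ex_intro _ a (conj Aa amin))).
Qed.

(* Norm-to-weak upper semicontinuity of A on bounded sets, tested against v. *)
Lemma bounded_part_usc (x v : X) (s M eta : R) : 0 < eta ->
  (forall x', A x x' -> x' v <= s) ->
  exists2 d, 0 < d & forall z a, A z a -> `|z - x| <= d -> `|a| <= M ->
    a v <= s + eta.
Proof.
move=> eta0 xs; apply: contrapT => H.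
(* For (z, a) in the graph with |z - x| <= e and |a| <= M, moving z to x costs at most (M + |y'|) e
   in the monotonicity inequality. A point common to all [C e] is thus related to the graph at x,
   hence lies in [A x]. *)
pose C (e : R) := [set a : dual X | `|a| <= M] `&` [set a | s + eta <= a v] `&`
  \bigcap_(p in [set p | A p.1 p.2])
    [set a : dual X | - ((M + `|p.2|) * e) <= (a - p.2) (x - p.1)].
have [|||||a aC] := @nested_convex_nonempty R (dual X) C M ucX'.
- move=> e e0; apply: contrapT => Ce; apply: H; exists e => // z a Az ze aM.
  rewrite leNgt; apply/negP => /ltW sv; apply: Ce; exists a.
  split; [by split|move=> [y y'] /= Ay].
  change (- ((M + `|y'|) * e) <= (a - y') (x - y)).
  have -> : (a - y') (x - y) = (a - y') (z - y) - (a - y') (z - x).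
    by rewrite -dual_appB opprB [z - y + _]addrC addrA subrK.
  have := mA.1 _ _ _ _ Az Ay; have := dual_app_le (a - y') (z - x).
  have : `|a - y'| * `|z - x| <= (M + `|y'|) * e.
    by rewrite ler_pM// (le_trans (ler_normB _ _))// lerD2r.
  lra.
- move=> e e0; apply: closedI; first apply: closedI.
  + apply: (preimage_closed _ (@closed_le _ _)) => y _; exact: norm_continuous.
  + apply: (preimage_closed _ (@closed_ge _ _)) => y _; exact: dual_eval_continuous.
  + by apply: closed_bigI => p _; exact: related_closed.
- move=> e a b e0 [[/= aM av] aA] [[/= bM bv] bA]; split.
    split; first by rewrite /mkset (le_trans (norm_mid_le _ _))//; lra.
    by rewrite /mkset !dualE; lra.
  by move=> p Ap; apply: related_mid; [exact: aA|exact: bA].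
- move=> d e d0 de a [[/= aM av] aA]; split => // p /= Ap.
  apply: le_trans (aA _ Ap); rewrite lerN2 ler_wpM2l// addr_ge0//.
  exact: le_trans aM.
- by move=> e a e0 [[]].
have [[_ /= av] _] := aC _ ltr01.
have : a v <= s; last by lra.
apply: xs; apply: (maximal_monotone_related mA) => y y' Ay.
have K0 : 0 < `|M| + `|y'| + 1 by rewrite ltr_wpDl// addr_ge0.
rewrite -[leRHS]opprK oppr_ge0; apply/ler_addgt0Pr => e e0; rewrite add0r.
have [_ /(_ (y, y') Ay) /=] := aC _ (divr_gt0 e0 K0).
rewrite lerNl => /le_trans; apply.
rewrite mulrA ler_pdivrMr// mulrC ler_wpM2l ?ltW//.
by have := ler_norm M; lra.
Qed.

End bounded_part.

(** * Directions that nearly realize the support function *)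

Section approximation.
Context {R : realType} (X : completeNormedModType R).
Variable A : X -> set (dual X).
Hypotheses (ucX : uniformly_convex X) (ucX' : uniformly_convex (dual X)).
Hypothesis mA : maximal_monotone A.

(* Take x + t w to be the resolvent of A at x + t v with parameter t mu, and let
   a be the associated element of A (x + t w), so that |w - v| = mu |a|.
   First mu is chosen small, which makes w close to v, and then t, which makes
   bounded elements of A (x + t w) nearly bounded by s in the direction v. *)
Lemma support_fun_approx (x v : X) (s eps : R) : 0 < eps ->
  (forall x', A x x' -> x' v <= s) ->
  (forall eta, 0 < eta -> exists2 x', A x x' & s - eta <= x' v) ->
  exists w t, [/\ `|w - v| < eps, 0 < t < eps, dom A (x + t *: w) &
    min_norm_sel A (x + t *: w) w <= s + eps].
Proof.
move=> eps0 xs sx.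
(* The final estimate is s + eta + (2 eta + L r) with L r <= eta. *)
pose eta := eps / 4; have eta0 : 0 < eta by rewrite divr_gt0.
have [x' Ax' sx'] := sx _ eta0.
pose L := `|x'|; have L0 : 0 <= L by exact: normr_ge0.
pose V := `|v|; have V0 : 0 <= V by exact: normr_ge0.
(* A bound on r = |w - v| valid for every mu <= 1: r^2 <= r V + L V + L r fails for r > K. *)
pose K := V + L + 1 + L * V.
have LV0 : 0 <= L * V by exact: mulr_ge0.
have K1 : 1 <= K by rewrite /K; lra.
have K0 : 0 < K by exact: lt_le_trans ltr01 K1.
pose rho := Num.min eps (eta / (L + 1)).
have L10 : 0 < L + 1 by rewrite ltr_wpDl.
have rho0 : 0 < rho by rewrite lt_min eps0 divr_gt0.
(* [D] strictly exceeds mu |a|^2, so r^2 = mu (mu |a|^2) < mu D <= rho^2. *)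
pose D := 2 * eta + L * K + 1.
have LK0 : 0 <= L * K by rewrite mulr_ge0// ltW.
have D0 : 0 < D by rewrite /D; lra.
pose mu := Num.min 1 (rho ^+ 2 / D).
have mu0 : 0 < mu by rewrite lt_min ltr01 divr_gt0// exprn_gt0.
have mu1 : mu <= 1 by rewrite ge_min lexx.
have muD : mu * D <= rho ^+ 2 by rewrite -ler_pdivlMr// ge_min lexx orbT.
(* K / mu bounds |a| = r / mu, and with it the norm of the minimal element [b]. *)
have [d d0 dP] := bounded_part_usc ucX' mA (K / mu) eta0 xs.
pose t := Num.min (eps / 2) (d / (V + K)).
have VK0 : 0 < V + K by rewrite ltr_wpDl.
have t0 : 0 < t by rewrite lt_min !divr_gt0.
have te : t < eps by rewrite gt_min; apply/orP; left; lra.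
have td : t * (V + K) <= d by rewrite -ler_pdivlMr// ge_min lexx orbT.
have [w [a [Aa wv awv]]] :=
  resolvent_exists x v ucX ucX' mA (ex_intro _ x (ex_intro _ x' Ax')) t0 mu0.
have Dw : dom A (x + t *: w) by exists a.
have [Ab bmin] := min_norm_selP ucX' mA Dw.
set b := min_norm_sel A (x + t *: w) in Ab bmin *.
have xwaw : x' w <= a w.
  have := mA.1 _ _ _ _ Aa Ax'; rewrite [x + _ - x]addrC addKr dual_appZ.
  by rewrite pmulr_rge0// dual_subE subr_ge0.
have wE (f : dual X) : f w = f v + f (w - v) by rewrite dual_appB addrC subrK.
set r := `|w - v| in wv; set n := `|a| in awv wv.
have r0 : 0 <= r by exact: normr_ge0.
have n0 : 0 <= n by exact: normr_ge0.
have key : mu * n ^+ 2 <= a v - x' v + L * r.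
  move: xwaw; rewrite !wE awv; have := dual_app_ge x' (w - v).
  by rewrite -/L -/r; lra.
have rK : r <= K.
  have : r ^+ 2 <= r * V + L * V + L * r.
    have := dual_app_le a v; have := dual_app_ge x' v; rewrite -/L -/V -/n => h1 h2.
    have h3 : mu * (mu * n ^+ 2) <= mu * (n * V + L * V + L * r).
      by apply: ler_wpM2l; [exact: ltW|lra].
    have h4 : mu * (L * V + L * r) <= L * V + L * r.
      by rewrite ler_piMl// addr_ge0// mulr_ge0.
    have -> : r ^+ 2 = mu * (mu * n ^+ 2) by rewrite wv; ring.
    have -> : r * V = mu * (n * V) by rewrite wv; ring.
    lra.
  move=> h; rewrite leNgt; apply/negP => Kr.
  have : 0 <= (r - K) * r by rewrite mulr_ge0// subr_ge0 ltW.
  have : 0 <= (r - 1) * (L * V) by rewrite mulr_ge0//; lra.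
  by rewrite /K; nra.
have nK : n <= K / mu by rewrite ler_pdivlMr// mulrC -wv.
have close : `|x + t *: w - x| <= d.
  rewrite [x + _ - x]addrC addKr normrZ gtr0_norm// (le_trans _ td)//.
  rewrite ler_pM2l// -(subrK v w) (le_trans (ler_normD _ _))// addrC.
  by rewrite lerD2l.
have av : a v <= s + eta by exact: dP Aa close nK.
have bv : b v <= s + eta by apply: dP Ab close _; rewrite (le_trans (bmin _ Aa)).
have key2 : mu * n ^+ 2 <= 2 * eta + L * r by lra.
have rrho : r < rho.
  suff : r ^+ 2 < rho ^+ 2 by rewrite ltr_sqr// nnegrE ltW.
  apply: lt_le_trans muD.
  have -> : r ^+ 2 = mu * (mu * n ^+ 2) by rewrite wv; ring.
  rewrite ltr_pM2l// (le_lt_trans key2)// /D.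
  have : L * r <= L * K by rewrite ler_wpM2l.
  lra.
have Lr : L * r <= eta.
  have : r * (L + 1) <= eta.
    by rewrite -ler_pdivlMr// (le_trans (ltW rrho))// ge_min lexx orbT.
  lra.
exists w, t; split => //.
- by rewrite (lt_le_trans rrho)// ge_min lexx.
- by rewrite t0 te.
rewrite wE; have : b (w - v) <= mu * n ^+ 2.
  apply: (le_trans (dual_app_le _ _)); rewrite -/r wv expr2 mulrCA.
  by rewrite ler_wpM2l ?(ltW mu0)// ler_wpM2r// bmin.
have : eps = 4 * eta by rewrite /eta; lra.
lra.
Qed.

End approximation.

(** * The formula for the support function *)

Unset Implicit Arguments.

Theorem theorem3p2 (R : realType) (X : completeNormedModType R)
    (ucX : uniformly_convex X) (ucX' : uniformly_convex (dual X))
    (A : X -> set (dual X)) (mA : maximal_monotone A)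
    (x v : X) (Dx : dom A x) (v0 : v != 0) :
  support_fun (A x) v =
  if v \in tangent_cone x (closure (dom A))
  then liminf_min_norm_sel A x v
  else +oo%E.
Proof.
have le_liminf : (support_fun (A x) v <= liminf_min_norm_sel A x v)%E.
  apply: ge_ereal_sup => _ [x' Ax' <-].
  apply/lee_addgt0Pr => e e0.
  have K0 : 0 < `|x'| + 1 by rewrite ltr_wpDl.
  (* With this radius |x' (w - v)| <= e; monotonicity between x + t w and x then bounds the
     selection paired with w below by x' w >= x' v - e. *)
  pose d := e / (`|x'| + 1).
  pose infd := ereal_inf [set (min_norm_sel A (x + p.2 *: p.1) p.1)%:E | p in
    [set p : X * R | [/\ `|p.1 - v| < d, 0 < p.2 < d & dom A (x + p.2 *: p.1)]]].
  apply: (@le_trans _ _ (infd + e%:E)%E).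
    rewrite -leeBlDr//; apply: le_ereal_inf_tmp => _ [[w t] /= [wv /andP[t0 _] Dw] <-].
    rewrite lee_fin; have [Ab _] := min_norm_selP ucX' mA Dw.
    have := mA.1 _ _ _ _ Ab Ax'; rewrite [x + _ - x]addrC addKr dual_appZ.
    rewrite pmulr_rge0// dual_subE subr_ge0; apply: le_trans.
    rewrite lerBlDr -lerBlDl -opprB lerNl -dual_appB.
    have := dual_app_ge x' (w - v); apply: le_trans; rewrite lerN2.
    move: wv; rewrite ltr_pdivlMr// => /ltW; apply: le_trans.
    by rewrite mulrC ler_wpM2l// lerDl.
  rewrite leeD2r//; apply: ereal_sup_ubound.
  by exists d => //=; rewrite divr_gt0.
(* An infinite support value makes both branches infinite, by [le_liminf]; a finite one forces [v]
   to be tangent. *)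
have [soo|sNoo] := eqVneq (support_fun (A x) v) +oo%E.
  rewrite soo; case: ifP => // _; apply/esym/eqP.
  by rewrite -leye_eq -soo.
have sgt : (-oo < support_fun (A x) v)%E.
  have [x' Ax'] := Dx; apply: (@lt_le_trans _ _ (x' v)%:E); first exact: ltNyr.
  by apply: ereal_sup_ubound; exists x'.
have [s sE] : exists s, support_fun (A x) v = s%:E.
  move: sNoo sgt; case: (support_fun (A x) v) => // s _ _; by exists s.
have xs x' : A x x' -> x' v <= s.
  by move=> Ax'; rewrite -lee_fin -sE; apply: ereal_sup_ubound; exists x'.
have sx eta : 0 < eta -> exists2 x', A x x' & s - eta <= x' v.
  move=> eta0; have /ereal_sup_gt[_ [x' Ax' <-]] :
    ((s - eta)%:E < support_fun (A x) v)%E by rewrite sE lte_fin ltrBlDr ltrDl.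
  by rewrite lte_fin => /ltW sx'; exists x'.
have approx := fun eps e0 => support_fun_approx ucX ucX' mA (eps := eps) e0 xs sx.
have vT : v \in tangent_cone x (closure (dom A)).
  apply/mem_set => B /nbhs_normP[e /= e0 eB].
  have [w [t [wv /andP[t0 _] Dw _]]] := approx e e0.
  exists w; split; last by apply: eB; rewrite /= distrC.
  exists t => //; exists (x + t *: w); first exact: subset_closure.
  by rewrite [x + _ - x]addrC addKr scalerK// gt_eqF.
rewrite vT; apply/eqP; rewrite eq_le le_liminf andTb sE.
apply: ge_ereal_sup => _ [e /= e0 <-]; apply/lee_addgt0Pr => e' e'0.
(* Below [e] the pair (w, t) is admissible in the infimum; below [e'] its value is at most s +
   e'. *)
pose eps := Num.min e e'.
have eps0 : 0 < eps by rewrite lt_min e0.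
have [w [t [wv /andP[t0 te] Dw ws]]] := approx eps eps0.
apply: (@le_trans _ _ (min_norm_sel A (x + t *: w) w)%:E).
  apply: ereal_inf_lbound; exists (w, t) => //=; split => //.
    by rewrite (lt_le_trans wv)// ge_min lexx.
  by rewrite t0 (lt_le_trans te)// ge_min lexx.
by rewrite -EFinD lee_fin (le_trans ws)// lerD2l ge_min lexx orbT.
Qed.
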